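(* Suppose the iterated function system $\mathcal{S}=\{S_i\}_{i=1}^k$ of similarities on $\mathbb{R}$ has self-similar set $K=[0,1]$ and (logarithmically) commensurate contraction factors. If $\mathcal{S}$ satisfies the weak separation condition, then $\mathcal{S}$ satisfies the convex finite type condition.
   Context: An iterated function system (IFS) $\mathcal{S}=\{S_i\}_{i=1}^k$ is a finite set of similarities $S_i(x)=r_ix+d_i:\mathbb{R}\to\mathbb{R}$ with $0<|r_i|<1$ and $k\ge 2$. Its self-similar set $K$ is the unique non-empty compact set with $K=\bigcup_{j=1}^k S_j(K)$. The contraction factors are (logarithmically) commensurate if $\log|r_i|/\log|r_j|\in\mathbb{Q}$ for all $i,j$. Words: $\Sigma=\{1,\dots,k\}$ and $\Sigma^*$ is the set of all finite words on $\Sigma$ (the empty word corresponds to the identity map, with ratio $1$). For $\sigma=(\sigma_1,\dots,\sigma_j)$ put $S_\sigma=S_{\sigma_1}\circ\cdots\circ S_{\sigma_j}$, $r_\sigma=\prod_{i=1}^j r_{\sigma_i}$ and (for $j\ge1$) $\sigma^-=(\sigma_1,\dots,\sigma_{j-1})$. For $\alpha>0$ let $\Lambda_\alpha=\{\sigma\in\Sigma^*: |r_\sigma|<\alpha\le |r_{\sigma^-}|\}$. Weak separation condition: there is some $x_0\in\mathbb{R}$ and an integer $N$ (or, equivalently, for all $x_0$ there is some $N$) such that for any $\alpha>0$ and any finite word $\tau$, any closed ball of radius $\alpha$ contains no more than $N$ distinct points of the form $S_\sigma(S_\tau(x_0))$ with $\sigma\in\Lambda_\alpha$. Convex finite type condition: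 for $V\subseteq\mathbb{R}$ let $\mathcal{E}_{\mathcal{S}}(V)=\bigcup_{\alpha>0}\{S_\sigma^{-1}\circ S_\tau:\sigma,\tau\in\Lambda_\alpha,\ S_\sigma(V)\cap S_\tau(V)\ne\emptyset\}$. A set $V$ is invariant if $S_j(V)\subseteq V$ for all $j$. $\mathcal{S}$ is of finite type if the contraction factors are logarithmically commensurate and $\mathcal{E}_{\mathcal{S}}(V)$ is finite for some non-empty bounded invariant open set $V$; it satisfies the convex finite type condition if this holds with $V$ the interior of the convex hull of $K$ (here $V=(0,1)$). *)

(* Defs.v *)
From HB Require Import structures.
From mathcomp Require Import all_boot all_order all_algebra.
From mathcomp Require Import all_classical all_reals all_analysis.

Set Implicit Arguments.
Unset Strict Implicit.
Unset Printing Implicit Defensive.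

Import Order.TTheory GRing.Theory Num.Theory.
Import numFieldNormedType.Exports.

Local Open Scope classical_set_scope.
Local Open Scope ring_scope.
Local Open Scope card_scope.

Record ifs (R : realType) (k : nat) := Ifs {
  ratio : 'I_k -> R;
  shift : 'I_k -> R;
  ifs_size_ge2 : (2 <= k)%N;
  ratio_bound : forall i, 0 < `|ratio i| < 1 }.

Section Ifs.
Context {R : realType} {k : nat} (S : ifs R k).
Implicit Types (i j : 'I_k) (s t : seq 'I_k) (V K : set R) (a : R).

Definition sim i (x : R) : R := ratio S i * x + shift S i.

Definition sim_inv i (y : R) : R := (y - shift S i) / ratio S i.

Definition word_map s : R -> R := foldr (fun i f => sim i \o f) id s.

Definition word_inv s : R -> R := foldr (fun i f => f \o sim_inv i) id s.

Definition word_ratio s : R := \prod_(i <- s) ratio S i.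

(* The word with its last letter removed; only used for nonempty words. *)
Definition parent s : seq 'I_k := take (size s).-1 s.

Definition Lambda a : set (seq 'I_k) :=
  [set s | s != [::] /\ `|word_ratio s| < a <= `|word_ratio (parent s)|].

(* Existence and uniqueness of such a [K] is Hutchinson's theorem. *)
Definition self_similar_set K :=
  [/\ K !=set0, compact K & K = \bigcup_j (sim j @` K)].

Definition commensurate :=
  forall i j, exists q : rat, ln `|ratio S i| / ln `|ratio S j| = ratr q.

(* [A #<= `I_N] says that [A] has at most [N] elements. *)
Definition weak_separation :=
  exists (x0 : R) (N : nat), forall (a : R) t (c : R), 0 < a ->
    [set word_map s (word_map t x0) | s in Lambda a] `&` closed_ball c a
      #<= `I_N.

Definition neighbour_maps V : set (R -> R) :=
  [set f | exists a s t,
    [/\ 0 < a, Lambda a s, Lambda a t,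
        (word_map s @` V) `&` (word_map t @` V) !=set0 &
        f = word_inv s \o word_map t]].

Definition invariant V := forall j, sim j @` V `<=` V.

Definition finite_type_wrt V :=
  [/\ commensurate,
      [/\ V !=set0, bounded_set V, invariant V & open V] &
      finite_set (neighbour_maps V)].

Definition finite_type := exists V, finite_type_wrt V.

Definition convex_hull K : set R := smallest (@convex_set R R^o) K.

Definition convex_finite_type :=
  exists K, self_similar_set K /\ finite_type_wrt (convex_hull K)°.

Lemma word_mapK s : cancel (word_map s) (word_inv s).
Proof.
elim: s => [|i s IHs] x //=; rewrite /sim_inv /sim addrK mulrC mulKf //.
by have /andP[r0 _] := ratio_bound S i; rewrite -normr_gt0.
Qed.

Lemma word_invK s : cancel (word_inv s) (word_map s).
Proof.
elim: s => [|i s IHs] x //=; rewrite IHs /sim_inv /sim mulrC divfK ?subrK //.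
by have /andP[r0 _] := ratio_bound S i; rewrite -normr_gt0.
Qed.

End Ifs.

(* Main.v *)
(* The weak separation condition bounds the number of distinct cells S_s[0, 1]
   of a given level through a point. A cover of a point of maximal size stays maximal
   under every S_s, so if the cells of two words s, t of comparable ratio overlap
   in a fixed proportion, a copy of the maximal cover inside the overlap forces
   S_s S_u = S_t S_v with u, v of bounded length: such pairs give finitely many
   neighbour maps. Small relative overlaps do not occur: follow the pair from the
   empty words, appending one letter at a time. A tiny overlap sits at the ends
   of both cells, so a further letter leaves its length unchanged while the
   cells shrink; hence a tiny overlap is smallest, in proportion, when it first
   arises from a pair with a large overlap, and there are only finitely many
   such pairs up to similarity. *)

Require Import Defs.
From mathcomp Require Import all_boot all_order all_algebra.
From mathcomp Require Import all_classical all_reals all_analysis.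
From mathcomp Require Import lra ring.
Import Order.TTheory GRing.Theory Num.Theory.
Import numFieldNormedType.Exports.
Local Open Scope classical_set_scope.
Local Open Scope ring_scope.

Lemma fin_lower_bound (R : realType) (T : finType) (f : T -> R) :
  (forall i, 0 < f i) -> exists c, 0 < c /\ forall i, c <= f i.
Proof.
move=> f_gt0; exists (\big[Num.min/1]_i f i); split; last by move=> i; exact: bigmin_le.
by apply: lt_bigmin.
Qed.

(** * Word maps as affine maps, and the levels [Lambda] *)

Section WordMaps.
Context {R : realType} {k : nat} (S : ifs R k).
Implicit Types (i j : 'I_k) (s t : seq 'I_k).

Lemma word_map_cat s t x :
  word_map S (s ++ t) x = word_map S s (word_map S t x).
Proof. by elim: s => //= i s ->. Qed.

Lemma word_ratio_cat s t :
  word_ratio S (s ++ t) = word_ratio S s * word_ratio S t.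
Proof. by rewrite /word_ratio big_cat. Qed.

Lemma word_mapB s x y :
  word_map S s x - word_map S s y = word_ratio S s * (x - y).
Proof.
elim: s => [|i s IHs] /=; first by rewrite /word_ratio big_nil mul1r.
by rewrite /sim /word_ratio big_cons -mulrA -IHs; ring.
Qed.

Lemma word_mapE s x : word_map S s x = word_ratio S s * x + word_map S s 0.
Proof. by rewrite -[x in RHS]subr0 -word_mapB subrK. Qed.

Lemma ratio_margin : exists c : R, 0 < c /\ forall i, c <= `|Defs.ratio S i| <= 1 - c.
Proof.
have : forall i, 0 < Num.min `|Defs.ratio S i| (1 - `|Defs.ratio S i|).
  by move=> i; have := ratio_bound S i; rewrite lt_min subr_gt0.
move=> /fin_lower_bound[c [c0 cP]].
exists c; split=> // i; have := cP i; rewrite le_min => /andP[-> ?] /=; lra.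
Qed.

Lemma word_ratio_gt0 s : 0 < `|word_ratio S s|.
Proof.
rewrite normr_gt0 prodf_seq_neq0; apply/allP => i _ /=.
by rewrite -normr_gt0; have /andP[] := ratio_bound S i.
Qed.

Lemma word_ratio_le1 s : `|word_ratio S s| <= 1.
Proof.
rewrite /word_ratio normr_prod prodr_ile1 // => i _.
by have /andP[? /ltW->] := ratio_bound S i; rewrite normr_ge0.
Qed.

Lemma word_map_inj s : injective (word_map S s).
Proof. exact: can_inj (word_mapK S s). Qed.

(** An affine map is determined by its values at two points, so maps can be counted through the
    images of two points, which weak separation controls. *)
Lemma eq_word_map s t p q : p != q -> word_map S s p = word_map S t p ->
  word_map S s q = word_map S t q -> word_map S s =1 word_map S t.
Proof.
move=> pq pE qE x; have rE : word_ratio S s = word_ratio S t.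
  by apply: (mulIf (_ : p - q != 0)); rewrite ?subr_eq0 // -!word_mapB pE qE.
by rewrite -(subrK (word_map S s p) (word_map S s x)) word_mapB rE -word_mapB pE subrK.
Qed.

Lemma size_le_of_word_ratio e : 0 < e ->
  exists n, forall s, e <= `|word_ratio S s| -> (size s <= n)%N.
Proof.
move=> e0; have [c [c0 cP]] := ratio_margin.
have i0 : 'I_k by exact: Ordinal (ifs_size_ge2 S).
have /andP[c_le c_ge] := cP i0.
have q_lt1 : `|1 - c| < 1 by rewrite ger0_norm; lra.
have /cvgrPdist_lt /(_ e e0) [n _ /(_ n)/= nP] := cvg_expr q_lt1.
exists n => s; apply: contraTT; rewrite -ltnNge -ltNge => n_lt.
have lt_e : (1 - c) ^+ n < e.
  by have := nP (leqnn n); rewrite sub0r normrN ger0_norm // exprn_ge0; lra.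
apply: le_lt_trans lt_e; apply: (@le_trans _ _ ((1 - c) ^+ size s)); last first.
  by apply: ler_wiXn2l; [lra|lra|exact: ltnW].
elim: s {n_lt} => [|i s IHs]; first by rewrite /word_ratio big_nil normr1.
rewrite /word_ratio big_cons normrM exprS ler_pM //.
by have /andP[] := cP i.
Qed.

Lemma parent_rcons s i : parent (rcons s i) = s.
Proof. by rewrite /parent size_rcons -cats1 take_size_cat. Qed.

Lemma Lambda_cat a s t : Lambda S a t ->
  Lambda S (`|word_ratio S s| * a) (s ++ t).
Proof.
case/lastP: t => [[]//|t i [_]]; rewrite parent_rcons => /andP[lt_a a_le].
split; first by case: (s); case: (t).
rewrite -rcons_cat parent_rcons rcons_cat !word_ratio_cat !normrM ltr_pM2l ?word_ratio_gt0 //.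
by rewrite lt_a ler_pM2l ?word_ratio_gt0.
Qed.

(** Before its last letter the word has ratio at least [a] in absolute value, and one letter costs
    at most a factor [c]. *)
Lemma Lambda_ratio_ge c a s : (forall i, c <= `|Defs.ratio S i|) -> 0 <= c ->
  Lambda S a s -> c * a <= `|word_ratio S s|.
Proof.
case/lastP: s => [_ _ []//|s i cP c0 [_]].
rewrite parent_rcons => /andP[_ a_le].
rewrite -cats1 word_ratio_cat normrM mulrC; apply: (@le_trans _ _ (`|word_ratio S s| * c)).
  exact: ler_wpM2r.
by apply: ler_wpM2l => //; rewrite /word_ratio big_seq1.
Qed.

End WordMaps.

(** * Covers of points of $[0,1]$ by cells of one level *)

Section UnitInterval.
Context {R : realType} {k : nat} (S : ifs R k).
Hypothesis hK : self_similar_set S `[0, 1].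
Implicit Types (i j : 'I_k) (s t : seq 'I_k).

Lemma sim_unit i x : 0 <= x <= 1 -> 0 <= sim S i x <= 1.
Proof.
case: hK => _ _ KE x01.
suff : [set` `[0, 1]] (sim S i x) by rewrite /= in_itv.
by rewrite KE; exists i => //; exists x => //=; rewrite in_itv.
Qed.

Lemma unit_sim x : 0 <= x <= 1 -> exists i y, 0 <= y <= 1 /\ x = sim S i y.
Proof.
case: hK => _ _ KE x01.
have : [set` `[0, 1]] x by rewrite /= in_itv.
rewrite KE => -[i _ [y /= y01 <-]]; by exists i, y.
Qed.

Lemma word_map_unit s x : 0 <= x <= 1 -> 0 <= word_map S s x <= 1.
Proof. by move=> x01; elim: s => //= i s; exact: sim_unit. Qed.

(** Descend through nested cells containing [x] until the ratio first drops below [e]; since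
    [e <= 1], the empty word does not stop the descent. *)
Lemma unit_Lambda e x : 0 < e <= 1 -> 0 <= x <= 1 ->
  exists s y, [/\ Lambda S e s, 0 <= y <= 1 & x = word_map S s y].
Proof.
move=> /andP[e0 e1] x01; have [n nP] := size_le_of_word_ratio S e e0.
suff main m :
    (exists s y, [/\ Lambda S e s, 0 <= y <= 1 & x = word_map S s y]) \/
    (exists s y, [/\ size s = m, e <= `|word_ratio S s|, 0 <= y <= 1 &
                     x = word_map S s y]).
  by case: (main n.+1) => // -[s [y [sn /nP]]]; rewrite sn ltnn.
elim: m => [|m [|[s [y [sm es y01 xE]]]]]; [|by left|].
  by right; exists [::], x; rewrite /word_ratio big_nil normr1.
have [i [z [z01 yE]]] := unit_sim y y01.
have xEz : x = word_map S (rcons s i) z by rewrite -cats1 word_map_cat /= -yE.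
have [esi|esi] := leP e `|word_ratio S (rcons s i)|.
  by right; exists (rcons s i), z; rewrite size_rcons sm.
left; exists (rcons s i), z; split=> //; split; first by case: (s).
by rewrite parent_rcons esi.
Qed.

Lemma orbit_dense x0 p e : 0 < e -> 0 <= p <= 1 ->
  exists t, `|word_map S t x0 - p| < e.
Proof.
(* [|x0| + 1] bounds the distance from [x0] to any point of $[0,1]$; the minimum with 1 meets the
   hypothesis of [unit_Lambda]. *)
move=> e0 p01; set e' := Num.min 1 (e / (`|x0| + 1)).
have D0 : 0 < `|x0| + 1 by rewrite ltr_wpDl.
have [|t [y [[_ /andP[te _]] y01 ->]]] := unit_Lambda e' p _ p01.
  by rewrite lt_min ltr01 divr_gt0 //= ge_min lexx.
exists t; rewrite word_mapB normrM.
apply: le_lt_trans (_ : _ <= `|word_ratio S t| * (`|x0| + 1)) _.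
  apply: ler_wpM2l => //; apply: le_trans (ler_normB _ _) _.
  by rewrite lerD2l ger0_norm; case/andP: y01.
by rewrite -ltr_pdivlMr // (lt_le_trans te) // ge_min lexx orbT.
Qed.

Definition covers (a y : R) s :=
  Lambda S a s /\ exists2 x, 0 <= x <= 1 & y = word_map S s x.

(** The points [p] and [q] are taken in the orbit of [x0] and inside $[0,1]$. Their images then lie
    in a cell through [y] of length less than [a], hence in the ball of radius [a] about [y], so
    each coordinate takes at most [N] values. *)
Lemma count_covers : weak_separation S -> exists p q M, p != q /\
  forall (a y : R) (l : seq (seq 'I_k)), 0 < a -> {in l, forall s, covers a y s} ->
    uniq [seq (word_map S s p, word_map S s q) | s <- l] -> (size l <= M)%N.
Proof.
move=> [x0 [N NP]].
have [||t tP] := orbit_dense x0 (1 / 4) (1 / 4); [lra|lra|].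
have [||u uP] := orbit_dense x0 (3 / 4) (1 / 4); [lra|lra|].
move: tP uP; rewrite !ltr_norml => /andP[t1 t2] /andP[u1 u2].
exists (word_map S t x0), (word_map S u x0), (N * N)%N.
split; first by apply: contraTneq t2 => ->; rewrite -leNgt; lra.
move=> a y l a0 lP l_uniq.
pose A v := [set word_map S s (word_map S v x0) | s in Lambda S a] `&` closed_ball y a.
pose L v : seq R := finmap.enum_fset (fset_set (A v)).
have LN v : (size (L v) <= N)%N by apply: geq_card_fset_set; exact: NP.
have LP v s : 0 <= word_map S v x0 <= 1 -> s \in l ->
    word_map S s (word_map S v x0) \in L v.
  move=> v01 /lP[s_a [x x01 yE]].
  have A_fin : finite_set (A v) by apply/finite_set_leP; exists N; exact: NP.
  apply: (etrans (in_fset_set A_fin _)).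
  apply/mem_set; split; first by exists s.
  rewrite closed_ballE // /closed_ball_ /= yE word_mapB normrM.
  have [_ /andP[/ltW s_le _]] := s_a.
  rewrite -[a]mulr1 ler_pM // ler_norml; lra.
rewrite -(size_map (fun s =>
  (word_map S s (word_map S t x0), word_map S s (word_map S u x0)))).
apply: leq_trans (leq_mul (LN t) (LN u)).
rewrite -(size_allpairs pair); apply: uniq_leq_size => // _ /mapP[s sl ->].
apply/allpairsP; exists (word_map S s (word_map S t x0), word_map S s (word_map S u x0)).
by split=> //; apply: LP => //; lra.
Qed.

(** Take a cover with the largest number of distinct maps. Prefixing [s] preserves that number, so a
    map outside the prefixed cover would exceed the maximum. *)
Lemma maximal_cover : weak_separation S -> exists (a y : R) (l : seq (seq 'I_k)),
  [/\ 0 < a, 0 <= y <= 1, {in l, forall s, Lambda S a s} &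
      forall s t, covers (`|word_ratio S s| * a) (word_map S s y) t ->
        exists2 u, u \in l & word_map S t =1 word_map S (s ++ u)].
Proof.
move=> /count_covers[p [q [M [pq MP]]]].
pose prox s := (word_map S s p, word_map S s q).
pose P n := `[< exists (a y : R) (l : seq (seq 'I_k)), [/\ 0 < a, 0 <= y <= 1,
  {in l, forall s, covers a y s}, uniq (map prox l) & size l = n] >].
have P0 : exists n, P n.
  by exists 0%N; apply/asboolP; exists 1, 0, [::]; rewrite ltr01 lexx ler01.
have PM n : P n -> (n <= M)%N.
  by move=> /asboolP[a [y [l [a0 _ lP lu <-]]]]; exact: MP lP lu.
case: (ex_maxnP P0 PM) => n /asboolP[a [y [l [a0 y01 lP lu ln]]]] n_max.
exists a, y, l; split=> // [s /lP[]//|s t t_cov].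
have [/mapP[u' /mapP[u ul ->] [pE qE]]|t_new] := boolP (prox t \in map prox (map (cat s) l)).
  exists u => //; exact: eq_word_map pq pE qE.
suff /n_max : P n.+1 by rewrite ltnn.
apply/asboolP; exists (`|word_ratio S s| * a), (word_map S s y), (t :: map (cat s) l).
split; last by rewrite /= size_map ln.
- by rewrite mulr_gt0 ?word_ratio_gt0.
- exact: word_map_unit.
- move=> v; rewrite inE => /predU1P[->//|/mapP[u /lP[ua [x x01 yE]] ->]].
  by split; [exact: Lambda_cat|exists x => //; rewrite word_map_cat -yE].
- rewrite map_cons cons_uniq t_new /= -map_comp.
  (* The pairs of the prefixed words are the images of the old pairs under the injective
     [word_map S s], hence still distinct. *)
  rewrite (_ : map _ l = map (fun z => (word_map S s z.1, word_map S s z.2)) (map prox l)).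
    rewrite map_inj_uniq // => -[z1 z2] [w1 w2] /= [] /word_map_inj-> /word_map_inj->//.
  by rewrite -map_comp; apply: eq_map => u /=; rewrite /prox !word_map_cat.
Qed.

End UnitInterval.

(** * Signed overlap length of two image intervals *)

Section Overlap.
Context {R : realType}.
Implicit Types (f g : R -> R).

Definition lo f : R := Num.min (f 0) (f 1).
Definition hi f : R := Num.max (f 0) (f 1).

(* The length of [f @` `[0, 1] `&` g @` `[0, 1]] when [f] and [g] are affine;
   negative when these intervals are disjoint. *)
Definition overlap f g : R := Num.min (hi f) (hi g) - Num.max (lo f) (lo g).

Lemma overlapC f g : overlap f g = overlap g f.
Proof. by rewrite /overlap minC maxC. Qed.

Lemma eq_overlap f f' g g' : f =1 f' -> g =1 g' -> overlap f g = overlap f' g'.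
Proof. by move=> ff' gg'; rewrite /overlap /lo /hi !ff' !gg'. Qed.

Lemma overlap_affine (r b : R) f g :
  overlap (fun x => r * f x + b) (fun x => r * g x + b) = `|r| * overlap f g.
Proof.
rewrite /overlap /lo /hi -!addr_minl -!addr_maxl -addr_minl opprD addrACA subrr addr0.
have [r0|r0] := leP 0 r.
  by rewrite ger0_norm // -!minr_pMr // -!maxr_pMr // -minr_pMr // mulrBr.
by rewrite ltr0_norm // -!minr_nMr ?ltW // -!maxr_nMr ?ltW // -minr_nMr ?ltW //; ring.
Qed.

(* An overlap shorter than [e] sits at an end of [`[0, 1]], hence is either
   missed or entirely contained in a subinterval [`[p, q]]. *)
Lemma small_overlap_eq (e p q A B : R) : 0 < e <= 1 ->
  e <= q - p -> e <= B - A -> (p == 0) || (e <= p) -> (q == 1) || (e <= 1 - q) ->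
  0 < Num.min q B - Num.max p A -> Num.min 1 B - Num.max 0 A < e ->
  Num.min q B - Num.max p A = Num.min 1 B - Num.max 0 A.
Proof.
move=> /andP[e0 e1] pq AB /orP[/eqP p0|pe] /orP[/eqP q1|qe]; subst=> //.
- case: (leP q B); case: (leP 1 B); case: (leP 0 A) => *; lra.
- case: (leP 1 B); case: (leP p A); case: (leP 0 A) => *; lra.
- case: (leP q B); case: (leP 1 B); case: (leP p A); case: (leP 0 A) => *; lra.
Qed.

End Overlap.

(** * Endpoints and overlaps of cells *)

Section WordOverlap.
Context {R : realType} {k : nat} (S : ifs R k).
Implicit Types (i j : 'I_k) (s t : seq 'I_k).

Lemma overlap_word_map s (f g : R -> R) :
  overlap (word_map S s \o f) (word_map S s \o g) = `|word_ratio S s| * overlap f g.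
Proof.
by rewrite -(overlap_affine _ (word_map S s 0)); apply: eq_overlap => x /=; rewrite word_mapE.
Qed.

Lemma lo_hi_word_map s (x : R) : 0 < x < 1 ->
  lo (word_map S s) < word_map S s x < hi (word_map S s).
Proof.
rewrite /lo /hi (word_mapE S s x) (word_mapE S s 1) => /andP[x0 x1].
have x1' : 0 < 1 - x by lra.
have := word_ratio_gt0 S s; rewrite normr_gt0 neq_lt => /orP[] r0.
  have h0 : word_ratio S s * x < 0 by rewrite nmulr_rlt0.
  have h1 : word_ratio S s * (1 - x) < 0 by rewrite nmulr_rlt0.
  by case: (leP (word_map S s 0)) => *; apply/andP; split; lra.
have h0 : 0 < word_ratio S s * x by rewrite pmulr_rgt0.
have h1 : 0 < word_ratio S s * (1 - x) by rewrite pmulr_rgt0.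
by case: (leP (word_map S s 0)) => *; apply/andP; split; lra.
Qed.

Lemma word_inv_unit s (x : R) : lo (word_map S s) <= x <= hi (word_map S s) ->
  0 <= word_inv S s x <= 1.
Proof.
rewrite -{1 2}(word_invK S s x); move: (word_inv S s x) => y.
rewrite /lo /hi (word_mapE S s y) (word_mapE S s 1).
have := word_ratio_gt0 S s; rewrite normr_gt0 neq_lt => /orP[] r0.
  rewrite -(nmulr_rle0 y r0) -[y <= 1]subr_ge0 -(nmulr_rle0 (1 - y) r0) mulrBr mulr1.
  by case: (leP (word_map S s 0)) => ? /andP[? ?]; apply/andP; split; lra.
rewrite -(pmulr_rge0 y r0) -[y <= 1]subr_ge0 -(pmulr_rge0 (1 - y) r0) mulrBr mulr1.
by case: (leP (word_map S s 0)) => ? /andP[? ?]; apply/andP; split; lra.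
Qed.

Lemma hi_subr_lo s : hi (word_map S s) - lo (word_map S s) = `|word_ratio S s|.
Proof.
have -> : word_ratio S s = word_map S s 1 - word_map S s 0 by rewrite word_mapB subr0 mulr1.
rewrite /hi /lo; case: leP => ?; first by rewrite ger0_norm // subr_ge0.
by rewrite ltr0_norm ?subr_lt0 // opprB.
Qed.

End WordOverlap.

(** * Relative overlaps of comparable cells, and finiteness of neighbour maps *)

Section Finiteness.
Context {R : realType} {k : nat} (S : ifs R k).
Hypotheses (hK : self_similar_set S `[0, 1]) (hwsc : weak_separation S).
Variable c : R.
Hypotheses (c_gt0 : 0 < c) (cP : forall i, c <= `|Defs.ratio S i|).
Implicit Types (i j : 'I_k) (s t : seq 'I_k).

Let c_lt1 : c < 1.
Proof.
pose i0 := Ordinal (ifs_size_ge2 S : (1 < k)%N).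
by apply: le_lt_trans (cP i0) _; have /andP[] := ratio_bound S i0.
Qed.

(** Holds for two words of the same level and, unlike sharing a level, survives removing the last
    letter of the word with the smaller ratio. *)
Definition comparable s t :=
  c * `|word_ratio S s| <= `|word_ratio S t| /\
  c * `|word_ratio S t| <= `|word_ratio S s|.

Local Notation ov s t := (overlap (word_map S s) (word_map S t)).

(* The image of the maximal cover under a word [s ++ w] with image inside the
   overlap is again maximal, so every subcell of [t] of that level through
   the point is one of its members. *)
Lemma finite_large_overlaps e : 0 < e -> exists n, forall s t, comparable s t ->
  e * `|word_ratio S s| <= ov s t ->
  exists u v, [/\ (size u <= n)%N, (size v <= n)%N &
                  word_map S (s ++ u) =1 word_map S (t ++ v)].
Proof.
move=> e0; have [a [y [l [a0 y01 lP l_max]]]] := maximal_cover S hK hwsc.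
(* The bound [e / 2] keeps the copied cover point within half the overlap length of the midpoint
   [z]; [c / a] ensures [e2 <= 1] below. *)
pose e' := Num.min 1 (Num.min (e / 2) (c / a)).
have e'0 : 0 < e' by rewrite !lt_min ltr01 !divr_gt0.
have [n1 n1P] := size_le_of_word_ratio S (c * e') (mulr_gt0 c_gt0 e'0).
have [n2 n2P] := size_le_of_word_ratio S (c * a) (mulr_gt0 c_gt0 a0).
(* The bounds [n1], [n2], [n3] are for the lengths of [w], [q], [p] below; the ratio of [p] is at
   least [c * e2], and [e2] at least [c * (c * e') * a]. *)
have [n3 n3P] : exists n, forall s,
    c * (c * (c * e') * a) <= `|word_ratio S s| -> (size s <= n)%N.
  by apply: size_le_of_word_ratio; rewrite !mulr_gt0.
exists (maxn (n1 + n2) n3) => s t [st ts] ov_ge.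
have rs := word_ratio_gt0 S s; have rt := word_ratio_gt0 S t.
move: ov_ge; rewrite /overlap; set A := Num.max _ _; set B := Num.min _ _ => AB.
have AB' : 0 < B - A by apply: lt_le_trans AB; rewrite mulr_gt0.
have inA (x : R) : A <= x <= B ->
    lo (word_map S s) <= x <= hi (word_map S s) /\ lo (word_map S t) <= x <= hi (word_map S t).
  by rewrite ge_max le_min => /andP[/andP[-> ->] /andP[-> ->]].
set z := (A + B) / 2.
have [|/word_inv_unit w01 _] := inA z; first by rewrite /z; apply/andP; split; lra.
have [|w [v [w_e v01 wE]]] := unit_Lambda S hK e' _ _ w01.
  by rewrite e'0 /e' ge_min lexx.
have [_ /andP[w_lt _]] := w_e.
have w_ge := Lambda_ratio_ge S c e' w cP (ltW c_gt0) w_e.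
have dist : `|word_map S (s ++ w) y - z| <= (B - A) / 2.
  rewrite -[z](word_invK S s) wE -word_map_cat word_mapB normrM.
  rewrite word_ratio_cat normrM.
  apply: (@le_trans _ _ (`|word_ratio S s| * (e / 2) * 1)).
    apply: ler_pM => //.
      apply: ler_wpM2l => //; apply: (le_trans (ltW w_lt)).
      by rewrite /e' ge_min ge_min lexx orbT.
    by rewrite ler_norml; lra.
  lra.
have [|_ /word_inv_unit u01] := inA (word_map S (s ++ w) y).
  by move: dist; rewrite ler_norml /z => /andP[? ?]; apply/andP; split; lra.
have rsw := word_ratio_gt0 S (s ++ w).
(* Chosen so that [t ++ p], with [p] of level [e2], has the level of the copied cover. *)
pose e2 := `|word_ratio S (s ++ w)| * a / `|word_ratio S t|.
have e2_le : 0 < e2 <= 1.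
  rewrite divr_gt0 ?mulr_gt0 //= ler_pdivrMr // mul1r; apply: le_trans st.
  rewrite word_ratio_cat normrM -mulrA [c * _]mulrC; apply: ler_wpM2l => //.
  by rewrite -ler_pdivlMr // (le_trans (ltW w_lt)) // !ge_min lexx !orbT.
have [p [x [p_e x01 xE]]] := unit_Lambda S hK e2 _ e2_le u01.
have e2E : `|word_ratio S t| * e2 = `|word_ratio S (s ++ w)| * a.
  by rewrite /e2 mulrC divfK // gt_eqF.
have [|q ql qE] := l_max (s ++ w) (t ++ p).
  split; first by rewrite -e2E; exact: Lambda_cat.
  by exists x => //; rewrite (word_map_cat S t p) -xE word_invK.
exists (w ++ q), p; split.
- rewrite leq_max size_cat leq_add //; first exact: n1P.
  by apply: n2P; apply: Lambda_ratio_ge (lP _ ql) => //; exact: ltW.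
- rewrite leq_max n3P ?orbT //.
  apply: le_trans (Lambda_ratio_ge S c e2 p cP (ltW c_gt0) p_e).
  apply: ler_wpM2l; first exact: ltW.
  rewrite ler_pdivlMr // mulrAC; apply: ler_wpM2r; first exact: ltW.
  rewrite word_ratio_cat normrM mulrAC; apply: ler_pM => //.
    by rewrite mulr_ge0 // ltW.
  by rewrite mulr_ge0 // ltW.
- by move=> x'; rewrite catA qE.
Qed.

(* Left: the overlap of [s] and [t] is large, and up to similarity there are
   finitely many such pairs. Right: it is small, see [small_overlap_eq]. *)
Lemma overlap_step : exists c1, 0 < c1 /\ forall s t i, comparable s t ->
  0 < ov (rcons s i) t ->
  c1 * `|word_ratio S s| <= ov (rcons s i) t \/ ov (rcons s i) t = ov s t.
Proof.
(* Each end of the cell of [i] either is an end of $[0,1]$ or stays at least [gap i] away from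
   it. *)
pose gap i := Num.min
  (if lo (sim S i) == 0 then c else Num.min c (lo (sim S i)))
  (if hi (sim S i) == 1 then c else Num.min c (1 - hi (sim S i))).
have sim01 i : 0 <= lo (sim S i) /\ hi (sim S i) <= 1.
  have := sim_unit S hK i 0; have := sim_unit S hK i 1.
  by rewrite /lo /hi !lexx ler01 le_min ge_max => /(_ isT)/andP[-> ->] /(_ isT)/andP[-> ->].
have gap0 i : 0 < gap i.
  have [] := sim01 i; rewrite /gap; move: (lo _) (hi _) => l h lo0 hi1; rewrite lt_min.
  case: eqVneq => [_|lo_neq]; case: eqVneq => [_|hi_neq]; rewrite ?lt_min ?c_gt0 //=.
  - by rewrite subr_gt0 lt_neqAle hi_neq.
  - by rewrite andbT lt0r lo_neq.
  - by rewrite subr_gt0 lt0r lo_neq lo0 lt_neqAle hi_neq.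
have [e [e0 e_gap]] := fin_lower_bound R _ gap gap0.
have gapP i : [/\ e <= c, (lo (sim S i) == 0) || (e <= lo (sim S i)) &
                 (hi (sim S i) == 1) || (e <= 1 - hi (sim S i))].
  have := e_gap i; rewrite /gap; move: (lo _) (hi _) => l h; rewrite le_min.
  by case: eqVneq => _; case: eqVneq => _ /=; rewrite ?le_min -?andbA;
    [case/andP|case/and3P|case/and3P|case/and4P]; split.
have [n nP] := finite_large_overlaps e e0.
(* For a large overlap, $S_s^{-1} S_t = S_u S_v^{-1}$ with [u], [v] of length at most [n], so the
   relative overlap is one of finitely many values of [F]. The constant [c1] bounds the positive
   ones from below; the others are replaced by 1. *)
pose F (p : 'I_k * n.-bseq 'I_k * n.-bseq 'I_k) :=
  overlap (sim S p.1.1) (word_map S p.1.2 \o word_inv S p.2).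
have [p|c1 [c10 c1P]] := fin_lower_bound R _ (fun p => if 0 < F p then F p else 1).
  by case: ifP.
exists c1; split=> // s t i st; have [s_t t_s] := st.
have rs := word_ratio_gt0 S s.
have ovE : ov (rcons s i) t =
    `|word_ratio S s| * overlap (sim S i) (word_inv S s \o word_map S t).
  rewrite -overlap_word_map; apply: eq_overlap => x /=; last by rewrite word_invK.
  by rewrite -cats1 word_map_cat.
have [e_ov|ov_e] := leP (e * `|word_ratio S s|) (ov s t).
  have [u [v [un vn uvE]]] := nP s t st e_ov.
  have FE : overlap (sim S i) (word_inv S s \o word_map S t) = F (i, Bseq un, Bseq vn).
    apply: eq_overlap => x //=.
    rewrite -{1}[x](word_invK S v) -word_map_cat -uvE word_map_cat word_mapK //.
  rewrite ovE FE pmulr_rgt0 // => F0; left; rewrite mulrC ler_pM2l //.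
  by have := c1P (i, Bseq un, Bseq vn); rewrite F0.
rewrite ovE pmulr_rgt0 // => h0; right.
have ovE' : ov s t = `|word_ratio S s| * overlap id (word_inv S s \o word_map S t).
  by rewrite -overlap_word_map; apply: eq_overlap => x //=; rewrite word_invK.
rewrite ovE'; congr (_ * _).
(* After applying $S_s^{-1}$ the cell of [s] is $[0,1]$ and that of [t] has length at least
   [c >= e], as [small_overlap_eq] requires. *)
move: ov_e h0; rewrite ovE' mulrC ltr_pM2r //.
set g := word_inv S s \o word_map S t => ov_e h0.
have [ec lo_gap hi_gap] := gapP i.
have id01 : lo (@id R) = 0 /\ hi (@id R) = 1.
  by rewrite /lo /hi; case: leP; rewrite ?ler01 // => /lt_geF; rewrite ler01.
move: ov_e h0; rewrite /overlap id01.1 id01.2 => ov_e h0.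
apply: (small_overlap_eq e) => //.
- by rewrite e0 (le_trans ec) // ltW.
- have := hi_subr_lo S [:: i]; rewrite /word_ratio big_seq1 => ->.
  exact: le_trans (cP i).
- have gE : hi g - lo g = overlap g g by rewrite /overlap minxx maxxx.
  rewrite gE -(ler_pM2r rs) [overlap _ _ * _]mulrC -overlap_word_map.
  rewrite (@eq_overlap _ _ (word_map S t) _ (word_map S t)).
  + by rewrite /overlap minxx maxxx hi_subr_lo; apply: le_trans s_t; rewrite ler_pM2r.
  + by move=> x /=; rewrite word_invK.
  + by move=> x /=; rewrite word_invK.
Qed.

(** Induction on the total length, stripping a letter from a word whose ratio is not the larger one.
    By [overlap_step] the overlap is large already or equals that of the shortened pair, whose bound
    is at least as strong. *)
Lemma overlap_lower_bound : exists e, 0 < e /\ forall s t, comparable s t ->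
  0 < ov s t -> e * `|word_ratio S s| <= ov s t.
Proof.
have [c1 [c10 c1P]] := overlap_step.
(* The 1 serves the pair of empty words; the factor [c] converts a bound by the ratio of [t] into
   one by the ratio of [s]. *)
pose e := Num.min 1 (c1 * c).
have e0 : 0 < e by rewrite lt_min ltr01 mulr_gt0.
have e_c1 : e <= c1 * c by rewrite ge_min lexx orbT.
have ratio_rcons s i : `|word_ratio S (rcons s i)| = `|word_ratio S s| * `|Defs.ratio S i|.
  by rewrite -cats1 word_ratio_cat normrM /word_ratio big_seq1.
have comparable_rcons s t i : comparable (rcons s i) t ->
    `|word_ratio S (rcons s i)| <= `|word_ratio S t| -> comparable s t.
  have := word_ratio_gt0 S s; have := cP i; have /andP[_] := ratio_bound S i.
  rewrite /comparable ratio_rcons => r1 rc rs [st ts] le_st; split.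
    by apply: le_trans le_st; rewrite mulrC ler_pM2l.
  by apply: le_trans ts _; rewrite ler_piMr // ltW.
have comparableC s t : comparable s t -> comparable t s by case.
have drop s t i : comparable (rcons s i) t -> 0 < ov (rcons s i) t ->
    `|word_ratio S (rcons s i)| <= `|word_ratio S t| ->
    [/\ comparable s t & c1 * `|word_ratio S s| <= ov (rcons s i) t \/
        ov (rcons s i) t = ov s t].
  by move=> st ov0 le_st; have := comparable_rcons _ _ _ st le_st; split=> //; exact: c1P.
have ratio_rcons_le s i : `|word_ratio S (rcons s i)| <= `|word_ratio S s|.
  by rewrite ratio_rcons ler_piMr //; have /andP[_ /ltW] := ratio_bound S i.
exists e; split=> // s t; have [m] := ubnP (size s + size t).
elim: m s t => // m IHm s t size_st st ov0.
have drop_s s' i : s = rcons s' i -> `|word_ratio S s| <= `|word_ratio S t| ->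
    e * `|word_ratio S s| <= ov s t.
  move=> sE; subst s => le_st; have [s't [le_ov|ovE]] := drop _ _ _ st ov0 le_st.
    apply: le_trans le_ov; apply: ler_pM => //; first exact: ltW.
    by apply: (le_trans e_c1); rewrite ler_piMr // ltW.
  rewrite ovE; apply: (@le_trans _ _ (e * `|word_ratio S s'|)).
    by apply: ler_wpM2l => //; exact: ltW.
  by apply: IHm => //; rewrite -?ovE //; move: size_st; rewrite size_rcons.
have drop_t t' i : t = rcons t' i -> `|word_ratio S t| <= `|word_ratio S s| ->
    e * `|word_ratio S s| <= ov s t.
  move=> tE; subst t => le_ts; rewrite overlapC in ov0 *.
  have [t's [le_ov|ovE]] := drop _ _ _ (comparableC _ _ st) ov0 le_ts.
    apply: le_trans le_ov; apply: (@le_trans _ _ (c1 * c * `|word_ratio S s|)).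
      exact: ler_wpM2r.
    rewrite -mulrA; apply: ler_wpM2l; first exact: ltW.
    by have [st' _] := st; apply: le_trans st' _; exact: ratio_rcons_le.
  rewrite ovE overlapC; apply: IHm; last by rewrite overlapC -ovE.
    by move: size_st; rewrite size_rcons addnS.
  exact: comparableC.
(* An empty word has the largest possible ratio, 1. If it is the one to be stripped, the ratios tie
   and the other word is stripped instead, unless both are empty. *)
have [le_st|lt_ts] := leP `|word_ratio S s| `|word_ratio S t|.
  case/lastP: s => [|s i] in size_st st ov0 drop_s drop_t le_st *;
    last exact: drop_s (erefl _) le_st.
  case/lastP: t => [|t i] in size_st st ov0 drop_s drop_t le_st *; last first.
    apply: drop_t (erefl _) _.
    by rewrite /word_ratio big_nil normr1 word_ratio_le1.
  rewrite /word_ratio big_nil normr1 mulr1 /overlap /lo /hi /=.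
  by rewrite minxx maxxx (min_l ler01) (max_r ler01) subr0 ge_min lexx.
case/lastP: t => [|t i] in size_st st ov0 drop_s drop_t lt_ts *;
  last exact: drop_t (erefl _) (ltW lt_ts).
have := word_ratio_le1 S s; rewrite leNgt; move: lt_ts.
by rewrite {1}/word_ratio big_nil normr1 => ->.
Qed.

(** Open cells that meet have positive overlap, hence a large one by [overlap_lower_bound]; the
    neighbour map is then $S_u S_v^{-1}$ with [u], [v] of bounded length. *)
Lemma finite_neighbours : finite_set (neighbour_maps S `]0, 1[).
Proof.
have [e [e0 eP]] := overlap_lower_bound.
have [n nP] := finite_large_overlaps e e0.
pose F (p : n.-bseq 'I_k * n.-bseq 'I_k) := word_map S p.1 \o word_inv S p.2.
apply: (@sub_finite_set _ _ (F @` setT)); last by apply: finite_image; exact: finite_finset.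
move=> f [a [s [t [a0 sa ta [x [[y /= y01 yE] [z /= z01 zE]]] ->]]]].
have s_ge := Lambda_ratio_ge S c a s cP (ltW c_gt0) sa.
have t_ge := Lambda_ratio_ge S c a t cP (ltW c_gt0) ta.
have [_ /andP[s_lt _]] := sa; have [_ /andP[t_lt _]] := ta.
have st : comparable s t.
  by split; [apply: le_trans t_ge|apply: le_trans s_ge]; rewrite ler_pM2l // ltW.
have ov0 : 0 < ov s t.
  rewrite in_itv /= in y01; rewrite in_itv /= in z01.
  have := lo_hi_word_map S s y y01; have := lo_hi_word_map S t z z01.
  rewrite yE zE => /andP[t1 t2] /andP[s1 s2].
  by rewrite /overlap subr_gt0 lt_min !gt_max !(lt_trans _ s2, lt_trans _ t2).
have [u [v [un vn uvE]]] := nP s t st (eP s t st ov0).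
exists (Bseq un, Bseq vn) => //; apply/funext => w /=.
by rewrite -{2}[w](word_invK S v) -word_map_cat -uvE word_map_cat word_mapK.
Qed.

End Finiteness.

(** * The convex hull of $[0,1]$ and the conclusion *)

Lemma convex_set_unit_itv (R : realType) :
  @convex_set R R^o (`[0, 1]%classic : set R).
Proof.
move=> x y p /set_mem; rewrite /= in_itv /= => /andP[x0 x1].
move=> /set_mem; rewrite /= in_itv /= => /andP[y0 y1].
apply/mem_set; rewrite /= in_itv /= [conv p x y](convRE x y p) /unstable.onem.
have p0 : 0 <= p%:num by [].
have p1 : p%:num <= 1 by [].
have q0 : 0 <= 1 - p%:num by rewrite subr_ge0.
apply/andP; split; first by rewrite addr_ge0 // mulr_ge0.
by rewrite -[leRHS](subrK p%:num) addrC lerD // ler_piMr.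
Qed.

Theorem corollary4p7 (R : realType) (k : nat) (S : ifs R k)
  (hK : self_similar_set S `[0, 1]%classic)
  (hcomm : commensurate S)
  (hwsc : weak_separation S) :
  convex_finite_type S.
Proof.
have hullE : (convex_hull (`[0, 1]%classic : set R))° = `]0, 1[%classic.
  rewrite /convex_hull smallest_id ?interior_itv_bnd //.
  exact: convex_set_unit_itv.
exists `[0, 1]%classic; split; rewrite // hullE; split=> //.
  split.
  - by exists (1 / 2); rewrite /= in_itv /=; apply/andP; split; lra.
  - exists 1; split; first exact: num_real.
    move=> M /ltW M1 x /=; rewrite in_itv /= => /andP[x0 x1].
    by apply: le_trans M1; rewrite ger0_norm ltW.
  (* An interior point goes strictly between the images of 0 and 1, which lie in $[0,1]$. *)
  - move=> i _ [x /= x01 <-]; rewrite in_itv /= in x01 *.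
    have /andP[lo_x x_hi] := lo_hi_word_map S [:: i] x x01.
    have /andP[l0 l1] : 0 <= sim S i 0 <= 1 by apply: sim_unit; rewrite // lexx ler01.
    have /andP[h0 h1] : 0 <= sim S i 1 <= 1 by apply: sim_unit; rewrite // lexx ler01.
    apply/andP; split.
      by apply: le_lt_trans lo_x; rewrite /lo le_min /= l0.
    by apply: (lt_le_trans x_hi); rewrite /hi ge_max /= l1.
  - exact: itv_open.
have [c [c0 cP]] := ratio_margin S.
apply: (finite_neighbours S hK hwsc c c0) => i.
by have /andP[] := cP i.
Qed.
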